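(* Let $\lambda_0,\lambda_1,c_0,c_1>0$ and let $[a,b]$, $a<b$, be a closed interval. Let $\{X(t)\}_{t\ge 0}$ be the telegraph process with drift, having velocity $c_0$ and switching intensity $\lambda_0$ when moving rightwards (direction $d_0$), and velocity $c_1$ and switching intensity $\lambda_1$ when moving leftwards (direction $d_1$). Let $D(t)$ be its direction at time $t$ and $\tau=\inf\{t>0:\ X(t)\notin[a,b]\}$. For $x\in[a,b]$ and $j=0,1$ put $$u_j(x)=\mathbb{P}\big(X(\tau)=b\,\big|\,X(0)=x,\ D(0)=d_j\big),\qquad u(x)=\mathbb{P}\big(X(\tau)=b\,\big|\,X(0)=x\big)=\frac{u_0(x)+u_1(x)}{2}.$$ Then for $x\in[a,b]$, $$u_0(x)=\frac{\lambda_0c_1\,e^{\left(\frac{\lambda_0}{c_0}-\frac{\lambda_1}{c_1}\right)x}-\lambda_1c_0\,e^{\left(\frac{\lambda_0}{c_0}-\frac{\lambda_1}{c_1}\right)a}}{\lambda_0c_1\,e^{\left(\frac{\lambda_0}{c_0}-\frac{\lambda_1}{c_1}\right)b}-\lambda_1c_0\,e^{\left(\frac{\lambda_0}{c_0}-\frac{\lambda_1}{c_1}\right)a}}$$ and $$u_1(x)=\frac{\lambda_1c_0\,e^{\left(\frac{\lambda_0}{c_0}-\frac{\lambda_1}{c_1}\right)x}-\lambda_1c_0\,e^{\left(\frac{\lambda_0}{c_0}-\frac{\lambda_1}{c_1}\right)a}}{\lambda_0c_1\,e^{\left(\frac{\lambda_0}{c_0}-\frac{\lambda_1}{c_1}\right)b}-\lambda_1c_0\,e^{\left(\frac{\lambda_0}{c_0}-\frac{\lambda_1}{c_1}\right)a}}.$$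 Consequently, $$u(x)=\frac12\;\frac{(\lambda_1c_0+\lambda_0c_1)\,e^{\left(\frac{\lambda_0}{c_0}-\frac{\lambda_1}{c_1}\right)x}-2\lambda_1c_0\,e^{\left(\frac{\lambda_0}{c_0}-\frac{\lambda_1}{c_1}\right)a}}{\lambda_0c_1\,e^{\left(\frac{\lambda_0}{c_0}-\frac{\lambda_1}{c_1}\right)b}-\lambda_1c_0\,e^{\left(\frac{\lambda_0}{c_0}-\frac{\lambda_1}{c_1}\right)a}}.$$
   Context: Telegraph process with drift: a particle starts at $X(0)=x\in[a,b]$ and at time $0$ starts moving rightwards (direction $d_0$) or leftwards (direction $d_1$), each with probability $\frac12$. While its direction is $d_0$ it moves right with velocity $c_0$ and reverses direction with intensity $\lambda_0$; while its direction is $d_1$ it moves left with velocity $c_1$ and reverses direction with intensity $\lambda_1$. The drift may come from the difference between the velocities, from the difference between the switching intensities, or from both. If the process starts at $b$ with direction $d_0$, it exits immediately through $b$; if it starts at $a$ with direction $d_1$, it exits immediately through $a$.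
   Formalization: The formal statement assumes λ0/c0 ≠ λ1/c1; when λ0/c0 = λ1/c1 (e.g. λ0=c0=1, λ1=c1=2) the numerators and the common denominator in the displayed formulas all vanish, so the formulas are undefined, and this is the only case excluded. *)

(* Defs.v *)
From HB Require Import structures.
From mathcomp Require Export all_boot all_order all_algebra.
From mathcomp Require Export all_classical all_reals all_analysis.

Set Implicit Arguments.
Unset Strict Implicit.
Unset Printing Implicit Defensive.

Import Order.TTheory GRing.Theory Num.Theory.
Import numFieldNormedType.Exports.

Local Open Scope classical_set_scope.
Local Open Scope ring_scope.

(* d0 is rightwards, d1 is leftwards; [j (+) odd n] is the direction reached
   from j after n reversals. *)
Notation direction := bool (only parsing).
Definition d0 : direction := false.
Definition d1 : direction := true.

Section telegraph.
Context {d : measure_display} {Omega : measurableType d} {R : realType}.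
Variable P : probability Omega R.

(* Equal to 0 when P B = 0. *)
Definition cond_prob (A B : set Omega) : R := fine (P (A `&` B)) / fine (P B).

(* Velocities are signed: c1 > 0 is the speed of the leftward motion. *)
Definition velocity (c0 c1 : R) (j : direction) : R :=
  if j == d0 then c0 else - c1.

Definition intensity (l0 l1 : R) (j : direction) : R :=
  if j == d0 then l0 else l1.

Definition reversal_time (S : nat -> {RV P >-> R}) (n : nat) (w : Omega) : R :=
  \sum_(i < n) S i w.

(* Given D(0) = j, the durations S_0, S_1, ... between consecutive reversals are
   independent, S_i being exponential with the intensity of the direction
   followed during the i-th period. *)
Definition sojourn_law (l0 l1 : R) (D0 : Omega -> direction)
    (S : nat -> {RV P >-> R}) : Prop :=
  forall (j : direction) (n : nat) (B : nat -> set R),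
    (forall i, measurable (B i)) ->
    cond_prob [set w | forall i, (i < n)%N -> B i (S i w)] [set w | D0 w = j]
    = \prod_(i < n) fine (exponential_prob (intensity l0 l1 (j (+) odd i)) (B i)).

(* Only times t >= 0 are meaningful.  Non-explosion of the reversal times needs
   no separate clause: it holds almost surely by [sojourn_law].  Continuity is
   required of every path, including those in the exceptional null set, so that
   exit events are measurable although P need not be complete. *)
Definition telegraph_process (l0 l1 c0 c1 x : R)
    (D : R -> {RV P >-> direction}) (X : R -> {RV P >-> R}) : Prop :=
  [/\ forall w, X 0 w = x,
      forall w, {within `[0, +oo[%classic, continuous (fun t => X t w)},
      forall j, P [set w | D 0 w = j] = (2^-1)%:E,
      exists S : nat -> {RV P >-> R},
        sojourn_law l0 l1 (D 0) S /\
        {ae P, forall w, forall (n : nat) (t : R),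
          reversal_time S n w <= t < reversal_time S n.+1 w ->
          D t w = D 0 w (+) odd n}
    & {ae P, forall w, forall (j : direction) (s t : R), 0 <= s <= t ->
        (forall r, s <= r < t -> D r w = j) ->
        X t w - X s w = velocity c0 c1 j * (t - s)}].

(* Equal to +oo if the path never leaves [a, b]. *)
Definition exit_time (a b : R) (X : R -> {RV P >-> R}) (w : Omega) : \bar R :=
  ereal_inf [set t%:E | t in [set t : R | 0 < t /\ X t w \notin `[a, b]]].

Definition exits_at (y a b : R) (X : R -> {RV P >-> R}) : set Omega :=
  [set w | exists2 tau : R, exit_time a b X w = tau%:E & X tau w = y].

End telegraph.

(* Main.v *)
From HB Require Import structures.
Require Import Defs.
From mathcomp Require Import all_boot all_order all_algebra.
From mathcomp Require Import all_classical all_reals all_analysis.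
From mathcomp Require Import measurable_realfun.
From mathcomp Require Import ring lra.

Import Order.TTheory GRing.Theory Num.Theory.
Import numFieldNormedType.Exports.

Local Open Scope classical_set_scope.
Local Open Scope ring_scope.

(** The position of the particle at its successive reversals is a random walk
    with independent exponential increments.  Freeze this walk as soon as it
    lies outside [a, b]; the event of leaving through b is then, up to a null
    set, the event that the frozen walk ends up above b.

    Let w_j denote the function claimed for u_j on [a, b], extended by 1 above b
    and by 0 below a ([absorbed]).  The two functions solve the system
      c0 w_0' = l0 (w_0 - w_1),     - c1 w_1' = l1 (w_1 - w_0)
    with w_0(b) = 1 and w_1(a) = 0 ([is_derive_exit_formula],
    [exit_formula_boundary]).  Integrating e^(-l s) w along one sojourn turns the
    system into the statement that the mean of w after the sojourn is its value
    before it ([integral_exponential_renewal]), so that the mean of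
    w(direction, frozen walk) stays equal to w_j(x) P(D(0) = j) for ever
    ([frozen_walk_invariant]).  As 1_{Y > b} <= w <= 1_{Y >= a}, this number lies
    between P(Y_n > b) and P(Y_n >= a), taken on the event D(0) = j.  These two
    differ by P(Y_n in [a, b]), which decays geometrically since every sojourn
    longer than the crossing time of the interval forces an exit
    ([frozen_walk_inside]).

    The path enters only through a second squeeze.  If Y_n > b the path has left
    through b, and if Y_n < a it has left through a, hence not through b
    ([frozen_walk_path]); so the exit probability lies between the same two
    bounds ([frozen_walk_squeeze]).  Only finitely many reversals are considered
    at a time, so the argument does not depend on whether the reversal times
    accumulate; that the path almost surely leaves the interval is a consequence
    of the decay.

    Two points of measure theory are needed along the way: S_n is independent of
    Y_n ([chain_indep]), which is deduced from the product rule on rectangles by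
    uniqueness of measures, and exit through b is an event, which holds because
    the continuity of all paths lets rational times decide it
    ([measurable_leaves_above]). *)

Set Implicit Arguments.
Unset Strict Implicit.
Unset Printing Implicit Defensive.

(** * Integration against a density and against independent pairs *)

Section density.
Local Open Scope ereal_scope.
Import HBNNSimple.

(** Both sides are monotone limits along the simple approximations of [f], and on
    indicators the identity is the hypothesis on [nu]. *)
Lemma ge0_integral_density d (T : measurableType d) (R : realType)
    (mu nu : {measure set T -> \bar R}) (g : T -> R) (f : T -> \bar R) :
  measurable_fun setT g -> (forall t, (0 <= g t)%R) ->
  (forall A, measurable A -> nu A = \int[mu]_(t in A) (g t)%:E) ->
  measurable_fun setT f -> (forall t, 0 <= f t) ->
  \int[nu]_t f t = \int[mu]_t (f t * (g t)%:E).
Proof.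
move=> mg g0 nuE mf f0.
pose h := nnsfun_approx measurableT mf.
have mgE : measurable_fun setT (fun t => (g t)%:E) by exact/measurable_EFinP.
have cvgh t : (h n t)%:E @[n --> \oo] --> f t.
  by apply: cvg_nnsfun_approx => // y _; exact: f0.
have ndh t : {homo (fun n => (h n t)%:E) : m n / (m <= n)%N >-> m <= n}.
  by move=> m n mn; rewrite lee_fin; exact/lefP/nd_nnsfun_approx.
have mh n : measurable_fun setT (fun t => (h n t)%:E).
  exact/measurable_EFinP/measurable_funP.
have -> : \int[nu]_t f t = limn (fun n => \int[nu]_t (h n t)%:E).
  under eq_integral do rewrite -(cvg_lim _ (cvgh _))//.
  by apply: monotone_convergence => // n t _; rewrite lee_fin.
have -> : \int[mu]_t (f t * (g t)%:E) =
    limn (fun n => \int[mu]_t ((h n t)%:E * (g t)%:E)).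
  have cvghg t : ((h n t)%:E * (g t)%:E) @[n --> \oo] --> f t * (g t)%:E.
    exact: cvgeZr.
  under eq_integral do rewrite -(cvg_lim _ (cvghg _))//.
  apply: monotone_convergence => // [n|n t _|t _ m n mn].
  - exact: emeasurable_funM.
  - by rewrite mule_ge0 ?lee_fin.
  - by rewrite lee_wpmul2r ?lee_fin//; exact: ndh.
congr (limn _); apply/funext => n.
have hE t : (h n t)%:E =
    \sum_(r \in range (h n)) (r * \1_(h n @^-1` [set r]) t)%:E.
  by rewrite fsumEFin // {1}fimfunE.
have mind r : measurable_fun setT
    (fun t => (r * \1_(h n @^-1` [set r]) t)%:E).
  by apply/measurable_EFinP/measurable_funM.
under eq_integral do rewrite hE.
rewrite ge0_integral_fsum//; last by move=> r t _; exact: nnfun_muleindic_ge0.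
transitivity (\int[mu]_t \sum_(r \in range (h n))
    ((r * \1_(h n @^-1` [set r]) t)%:E * (g t)%:E)); last first.
  apply: eq_integral => t _; rewrite hE ge0_mule_fsuml// => r.
  exact: nnfun_muleindic_ge0.
rewrite ge0_integral_fsum//; last 2 first.
- by move=> r; exact: emeasurable_funM.
- by move=> r t _; rewrite mule_ge0 ?lee_fin ?g0//; exact: nnfun_muleindic_ge0.
apply: eq_fsbigr => r; rewrite inE => -[t0 _ <-].
under eq_integral do rewrite EFinM.
under [RHS]eq_integral do rewrite EFinM -muleA.
have mi : measurable_fun setT (fun t => (\1_(h n @^-1` [set h n t0]) t)%:E : \bar R).
  exact/measurable_EFinP.
rewrite !ge0_integralZl//.
- rewrite integral_indic// setIT nuE// integral_mkcond; congr (_ * _).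
  by apply: eq_integral => t _; rewrite epatch_indic muleC.
- exact: emeasurable_funM.
- by move=> t _; rewrite mule_ge0 ?lee_fin.
- by rewrite lee_fin.
- by rewrite lee_fin.
Qed.
End density.

Section independence.
Local Open Scope ereal_scope.

(** Rectangles form a pi-system that generates the product sigma-algebra. *)
Lemma measure_eq_on_rectangles d1 d2 (T1 : measurableType d1)
    (T2 : measurableType d2) (R : realType)
    (m1 m2 : {measure set (T1 * T2) -> \bar R}) :
  m1 setT < +oo ->
  (forall A B, measurable A -> measurable B -> m1 (A `*` B) = m2 (A `*` B)) ->
  forall E, measurable E -> m1 E = m2 E.
Proof.
move=> m1oo m12 E mE.
pose G := [set A `*` B | A in @measurable d1 T1 & B in @measurable d2 T2].
apply: (measure_unique G (fun=> setT)) => //.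
- by rewrite measurable_prod_measurableType.
- move=> _ _ [A1 mA1 [B1 mB1 <-]] [A2 mA2 [B2 mB2 <-]]; rewrite -setXI.
  exists (A1 `&` A2); first exact: measurableI.
  by exists (B1 `&` B2); first exact: measurableI.
- by move=> _; exists setT => //; exists setT => //; rewrite setXTT.
- by rewrite bigcup_const.
- by move=> _ [A mA [B mB <-]]; exact: m12.
Qed.

Section finite_pushforward.
Context d d1 (Omega : measurableType d) (T1 : measurableType d1) (R : realType).
Variables (mu : {finite_measure set Omega -> \bar R}) (Y : Omega -> T1).
Hypothesis mY : measurable_fun setT Y.

Let nu : {measure set T1 -> \bar R}.
Proof.
refine (pushforward mu Y : {measure set T1 -> \bar R}).
Unshelve. exact: mY.
Defined.

(** The measurability proof is an argument so that [law] can be inferred to be a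
    finite measure. *)
Definition law of measurable_fun setT Y := pushforward mu Y.

HB.instance Definition _ := isMeasure.Build _ _ _ (law mY)
  (measure0 nu) (measure_ge0 nu) (@measure_semi_sigma_additive _ _ _ nu).

Let fin_num_law : fin_num_fun (law mY).
Proof.
by move=> A mA; apply: fin_num_measure; rewrite -[X in measurable X]setTI; exact: mY.
Qed.

HB.instance Definition _ := Measure_isFinite.Build _ _ _ (law mY) fin_num_law.
End finite_pushforward.
(** The product rule says that the law of the pair [(Y, S)] is the product of the
    law of [Y] with [nu], and Tonelli applies to the latter. *)
Lemma ge0_integral_indep d d1 d2 (Omega : measurableType d)
    (T1 : measurableType d1) (T2 : measurableType d2) (R : realType)
    (mu : {finite_measure set Omega -> \bar R}) (nu : probability T2 R)
    (Y : Omega -> T1) (S : Omega -> T2) (h : T1 * T2 -> \bar R) :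
  measurable_fun setT Y -> measurable_fun setT S ->
  (forall A B, measurable A -> measurable B ->
    mu (Y @^-1` A `&` S @^-1` B) = mu (Y @^-1` A) * nu B) ->
  measurable_fun setT h -> (forall z, 0 <= h z) ->
  \int[mu]_w h (Y w, S w) = \int[mu]_w \int[nu]_s h (Y w, s).
Proof.
move=> mY mS YS mh h0.
have mYS : measurable_fun setT (fun w => (Y w, S w)) by exact/measurable_fun_pair.
pose lY : {finite_measure set T1 -> \bar R} := law mu mY.
pose lYS : {finite_measure set (T1 * T2)%type -> \bar R} := law mu mYS.
transitivity (\int[lYS]_z h z).
  by rewrite (ge0_integral_pushforward mYS).
have lYSE A : measurable A -> lYS A = (lY \x nu) A.
  move=> mA; apply/esym/product_measure_unique => // B C mB mC; exact: YS.
rewrite (eq_measure_integral (lY \x nu)); last by move=> A mA _; exact: lYSE.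
rewrite (@fubini_tonelli1 _ _ _ _ _ lY nu h)//.
rewrite (ge0_integral_pushforward mY)//.
- exact: measurable_fun_fubini_tonelli_F.
- by move=> y _; apply: integral_ge0.
Qed.
End independence.

(** * Markov chains driven by independent noise *)

Lemma measurable_preimage dV dW (V : measurableType dV) (W : measurableType dW)
    (g : V -> W) A :
  measurable_fun setT g -> measurable A -> measurable (g @^-1` A).
Proof. by move=> mg mA; rewrite -[X in measurable X]setTI; exact: mg. Qed.

Section driven_chain.
Local Open Scope ereal_scope.
Context d dT dU (Omega : measurableType d) (T : measurableType dT)
  (U : measurableType dU) (R : realType).
Variables (mu : {finite_measure set Omega -> \bar R}) (nu : nat -> probability U R).
Variables (S : nat -> Omega -> U) (f : nat -> T * U -> T) (x : T).
Hypothesis mS : forall n, measurable_fun setT (S n).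
Hypothesis mf : forall n, measurable_fun setT (f n).
Hypothesis S_law : forall n (B : nat -> set U), (forall i, measurable (B i)) ->
  mu [set w | forall i, (i < n)%N -> B i (S i w)] =
  mu setT * (\prod_(i < n) fine (nu i (B i)))%:E.

Fixpoint chain (n : nat) (w : Omega) : T :=
  if n is m.+1 then f m (chain m w, S m w) else x.

Lemma measurable_chain n : measurable_fun setT (chain n).
Proof.
elim: n => [|n IH] /=; first exact: measurable_cst.
by apply: (measurableT_comp (mf n)); exact/measurable_fun_pair.
Qed.
#[local] Hint Resolve measurable_chain : core.

(** Induction on [n] requires the statement for arbitrarily many future steps:
    conditioning on the steps after [n] shows that the law of
    [(chain n, S n)] restricted to the future event [F] is proportional to its
    unrestricted law, because both agree on rectangles by the induction
    hypothesis.  Evaluating both on [f n @^-1` A] is the case of [n.+1]. *)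
Lemma chain_indep_future n k (A : set T) (C : nat -> set U) :
  measurable A -> (forall i, measurable (C i)) ->
  mu (chain n @^-1` A `&` [set w | forall i, (i < k)%N -> C i (S (n + i) w)]) =
  mu (chain n @^-1` A) * (\prod_(i < k) fine (nu (n + i) (C i)))%:E.
Proof.
elim: n k A C => [|n IH] k A C mA mC.
  have [xA|xA] := pselect (A x).
  - have -> : chain 0 @^-1` A = setT by apply/seteqP; split.
    by rewrite setTI S_law.
  - have -> : chain 0 @^-1` A = set0 by apply/seteqP; split.
    by rewrite set0I measure0 mul0e.
pose F := [set w | forall i, (i < k)%N -> C i (S (n.+1 + i) w)].
have mF : measurable F.
  have -> : F = \bigcap_(i in `I_k) (S (n.+1 + i) @^-1` C i).
    by apply/seteqP; split => w Fw i ik; exact: Fw.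
  by apply: bigcap_measurableType => // i _; exact: measurable_preimage.
pose p := (\prod_(i < k) fine (nu (n.+1 + i) (C i)))%R.
have p0 : (0 <= p)%R by apply: prodr_ge0 => i _; exact: fine_ge0.
have mYS : measurable_fun setT (fun w => (chain n w, S n w)).
  exact/measurable_fun_pair.
have agree (E : set (T * U)) : measurable E ->
    law (mrestr mu mF) mYS E = mscale (NngNum p0) (law mu mYS) E.
  apply: measure_eq_on_rectangles => [|B D mB mD].
    rewrite -ge0_fin_numE//; exact: fin_num_measure.
  rewrite /mscale/= /law /pushforward /mrestr /=.
  have IH1 := IH 1%N B (fun=> D) mB (fun=> mD).
  have IHk := IH k.+1 B (fun i => if i is j.+1 then C j else D) mB.
  transitivity (mu (chain n @^-1` B) * (fine (nu n D) * p)%:E).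
    rewrite (_ : _ `&` F = chain n @^-1` B `&`
      [set w | forall i, (i < k.+1)%N ->
         (if i is j.+1 then C j else D) (S (n + i) w)]).
      rewrite IHk; last by case.
      rewrite big_ord_recl /= addn0; congr (_ * (_ * _)%:E).
      by apply: eq_bigr => i _; rewrite addSnnS.
    apply/seteqP; split => w /=.
    - move=> [[Bw Dw] Fw]; split => // -[_|j jk]; first by rewrite addn0.
      by rewrite -addSnnS; exact: Fw.
    - move=> [Bw h]; split; first by split => //; rewrite -(addn0 n); exact: (h 0%N).
      by move=> i ik; rewrite addSnnS; exact: (h i.+1).
  rewrite -[RHS]/(p%:E * mu ((fun w => (chain n w, S n w)) @^-1` (B `*` D))).
  rewrite (_ : _ @^-1` (B `*` D) = chain n @^-1` B `&`
      [set w | forall i, (i < 1)%N -> D (S (n + i) w)]).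
    by rewrite IH1 big_ord1 addn0 muleCA -EFinM mulrC.
  apply/seteqP; split => w /=.
  - by move=> [Bw Dw]; split => // -[_|//]; rewrite addn0.
  - by move=> [Bw h]; split => //; rewrite -(addn0 n); exact: (h 0%N).
have := agree (f n @^-1` A) (measurable_preimage (mf n) mA).
by rewrite /mscale/= /law /pushforward /mrestr /= -/F muleC.
Qed.

Lemma chain_indep n (A : set T) (C : set U) : measurable A -> measurable C ->
  mu (chain n @^-1` A `&` S n @^-1` C) = mu (chain n @^-1` A) * nu n C.
Proof.
move=> mA mC; have := chain_indep_future n 1 mA (fun=> mC).
rewrite big_ord1 addn0 fineK ?fin_num_measure// => <-; congr (mu (_ `&` _)).
apply/seteqP; split => w /=; first by move=> Cw [_|//]; rewrite addn0.
by move=> /(_ 0%N isT); rewrite addn0.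
Qed.

(** If [g n] is at each time the mean of [g n.+1] after one step, then
    [g n (chain n)] is a martingale, so its mean is constant. *)
Lemma integral_chain_invariant (g : nat -> T -> \bar R) :
  (forall n, measurable_fun setT (g n)) -> (forall n y, 0 <= g n y) ->
  (forall n y, \int[nu n]_s g n.+1 (f n (y, s)) = g n y) ->
  forall n, \int[mu]_w g n (chain n w) = g 0%N x * mu setT.
Proof.
move=> mg g0 gE; elim => [|n IH] /=; first by rewrite integral_cst.
rewrite -IH; under [RHS]eq_integral do rewrite -gE.
apply: (ge0_integral_indep (h := g n.+1 \o f n)) => //.
- exact: chain_indep.
- exact: measurableT_comp.
- by move=> z; exact: g0.
Qed.

(** Being in [I] after a step forces the noise of that step into [J n], which
    is independent of the past and has probability at most [rho]. *)
Lemma chain_stay (I : set T) (J : nat -> set U) (rho : R) :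
  measurable I -> (forall n, measurable (J n)) ->
  (forall n z, I (f n z) -> I z.1 /\ J n z.2) ->
  (forall n, nu n (J n) <= rho%:E) ->
  forall n, mu (chain n @^-1` I) <= (rho ^+ n)%:E * mu setT.
Proof.
move=> mI mJ IJ nuJ; elim => [|n IH].
  by rewrite mul1e; apply: le_measure; rewrite ?inE//; exact: measurable_preimage.
have rho0 : 0 <= rho%:E by exact: le_trans (nuJ 0%N).
apply: (@le_trans _ _ (mu (chain n @^-1` I `&` S n @^-1` J n))).
  apply: le_measure; rewrite ?inE//; [exact: measurable_preimage| |by move=> w /IJ].
  by apply: measurableI; exact: measurable_preimage.
rewrite chain_indep// exprS EFinM -muleA muleC lee_pmul//.
Qed.

End driven_chain.

(** * One exponential sojourn *)

Section exponential.
Context {R : realType}.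
Local Notation mu := (@lebesgue_measure R).

(** The exponential law is a probability measure only for a positive rate; the
    proof is kept as an argument so that families of such laws can be formed. *)
Definition exponentialP (r : R) (r0 : 0 < r) : probability (measurableTypeR R) R.
Proof.
refine (exponential_prob r : probability _ _).
Unshelve. exact: r0.
Defined.

Lemma is_derive_expRMl (r x : R) : is_derive x 1 (fun y => expR (r * y)) (r * expR (r * x)).
Proof.
have h : is_derive x 1 (expR \o ( *%R r)) (expR (r * x) * r).
  by apply: is_derive1_comp; apply: is_derive_eq; rewrite /GRing.scale/= mulr1.
by move: h; rewrite mulrC.
Qed.

Lemma continuous_expRMl (r : R) : continuous (fun y : R => expR (r * y)).
Proof.
move=> x; apply: differentiable_continuous; apply/derivable1_diffP.
by have [] := is_derive_expRMl r x.
Qed.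

Lemma cvg_expRMl_pinfty (r : R) : 0 < r -> expR (- r * x) @[x --> +oo] --> (0 : R).
Proof.
move=> r0.
under eq_fun do rewrite mulNr.
apply: (@cvg_comp _ _ _ (fun x => r * x) (fun z => expR (- z)) _ (pinfty_nbhs R)).
  exact: gt0_cvgMry.
exact: cvgr_expR.
Qed.

Lemma exponential_prob_tail (r L : R) : 0 < r -> 0 <= L ->
  exponential_prob r `]L, +oo[ = (expR (- r * L))%:E.
Proof.
move=> r0 L0; rewrite /exponential_prob.
rewrite integral_itv_obnd_cbnd; last first.
  apply/measurable_EFinP; apply: measurable_funS (measurable_exponential_pdf _) => //.
have dF (y : R) : is_derive y 1 (fun x : R => - expR (- r * x)) (r * expR (- r * y)).
  apply: (is_derive_eq (is_deriveN (is_derive_expRMl (- r) y))).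
  by rewrite mulNr opprK.
have cF : continuous (fun x : R => - expR (- r * x)).
  move=> x; apply: differentiable_continuous; apply/derivable1_diffP.
  by have [] := dF x.
rewrite (@ge0_continuous_FTC2y _ _ (fun x => - expR (- r * x)) _ 0).
- by rewrite -EFinB sub0r opprK.
- by move=> x _; apply: exponential_pdf_ge0; exact: ltW.
- apply: (@continuous_subspaceW R^o _ _ [set` `[0, +oo[%R]).
    by move=> x /=; rewrite !in_itv/= !andbT; exact: le_trans.
  exact: within_continuous_exponential_pdf.
- by rewrite -oppr0; apply: cvgN; exact: cvg_expRMl_pinfty.
- by move=> x _; have [] := dF x.
- by apply: cvg_at_right_filter; exact: cF.
- move=> x; rewrite in_itv/= andbT => Lx.
  rewrite derive1E exponential_pdfE ?(le_trans L0 (ltW Lx))//.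
  by have [_ ->] := dF x.
Qed.

(** The value function of a walk that is frozen once outside [a, b], where
    ending above [b] is worth 1 and ending below [a] is worth 0. *)
Definition absorbed (a b : R) (q : R -> R) (y : R) : R :=
  if y < a then 0 else if b < y then 1 else q y.

Lemma measurable_absorbed a b q : measurable_fun setT q ->
  measurable_fun setT (absorbed a b q).
Proof.
move=> mq; apply: measurable_fun_ifT => //.
  exact: measurable_fun_ltr.
by apply: measurable_fun_ifT => //; exact: measurable_fun_ltr.
Qed.

Lemma absorbed_in a b q y : a <= y <= b -> absorbed a b q y = q y.
Proof. by move=> /andP[ay yb]; rewrite /absorbed !ltNge ay yb. Qed.

(** First-sojourn equation.  The particle starts at [y], moves with velocity [v]
    for an exponential time of rate [l], and is then worth [q], or the boundary
    value if it has crossed the end [e] of the interval that it is heading for.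
    With [L] the time to reach [e], the equation [v p' = l (p - q)] makes
    [- e^(- l s) p(y + v s)] a primitive of [l e^(- l s) q(y + v s)] on [0, L];
    the primitive contributes [p y - e^(- l L) p e], and the second term is
    compensated by the event of a sojourn longer than [L]. *)
Lemma integral_exponential_renewal (l v a b : R) (p q : R -> R) (y : R)
    (l0 : 0 < l) (v0 : v != 0) :
  a <= y <= b ->
  (forall z : R, is_derive z 1 p (l / v * (p z - q z))) ->
  p (if 0 < v then b else a) = (if 0 < v then 1 else 0) ->
  continuous q -> (forall z, a <= z <= b -> 0 <= q z) ->
  (\int[exponentialP l0]_s (absorbed a b q (y + v * s))%:E = (p y)%:E)%E.
Proof.
move=> yab dp pe cq q0; set e := if 0 < v then b else a.
have [ay yb] := andP yab.
have mq : measurable_fun setT q by exact: continuous_measurable_fun.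
pose W s := absorbed a b q (y + v * s).
have W0 s : 0 <= W s.
  rewrite /W /absorbed; case: ltP => // h1; case: ltP => // h2.
  by apply: q0; rewrite h1.
have mW : measurable_fun setT W.
  apply: (measurableT_comp (measurable_absorbed a b mq)).
  by apply: measurable_funD => //; exact: measurable_funM.
have pdf0 s : 0 <= exponential_pdf l s by apply: exponential_pdf_ge0; exact: ltW.
rewrite (@ge0_integral_density _ _ _ mu _ (exponential_pdf l))//; last 2 first.
- exact: measurable_exponential_pdf.
- exact/measurable_EFinP.
under eq_integral do rewrite -EFinM.
pose h s := W s * exponential_pdf l s.
rewrite -[LHS]/(\int[mu]_(s in setT) (h s)%:E)%E.
have mh : measurable_fun setT h.
  by apply: measurable_funM => //; exact: measurable_exponential_pdf.
have h0 s : (0 <= (h s)%:E)%E by rewrite lee_fin mulr_ge0.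
(* [e] is the end ahead of the particle and [L] the time to reach it. *)
pose L := (e - y) / v.
have L0 : 0 <= L.
  rewrite /L /e; case: (ltP 0 v) => v_gt0.
    by rewrite divr_ge0 ?subr_ge0// ltW.
  by rewrite -mulrNN -invrN divr_ge0 ?opprB ?subr_ge0// oppr_ge0.
have Lv : y + v * L = e by rewrite /L mulrC divfK// addrC subrK.
have inside s : 0 <= s <= L -> a <= y + v * s <= b.
  move=> /andP[s0 sL]; move: Lv; rewrite /e; case: (ltP 0 v) => v_gt0 Lv.
    rewrite (le_trans ay) ?lerDl ?mulr_ge0 ?(ltW v_gt0)//=.
    by rewrite -Lv lerD2l ler_pM2l.
  rewrite andbC (le_trans _ yb) ?gerDl ?mulr_le0_ge0//=.
  by rewrite -Lv lerD2l ler_wnM2l.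
have outside s : L < s -> W s = p e.
  move=> Ls; rewrite /W /absorbed pe; move: Lv; rewrite /e; case: (ltP 0 v) => v_gt0 Lv.
    have bys : b < y + v * s by rewrite -Lv ltrD2l ltr_pM2l.
    by rewrite bys ltNge (ltW (le_lt_trans (le_trans ay yb) bys)).
  have -> // : y + v * s < a.
  by rewrite -Lv ltrD2l ltr_nM2l// lt_neqAle v0.
have -> : [set: R] = `]-oo, 0[ `|` (`[0, L] `|` `]L, +oo[).
  apply/seteqP; split => // s _ /=; rewrite !in_itv/= andbT.
  by case: (ltP s 0) => [|s0]; [left|right; case: (leP s L) => sL; [left|right]].
have mhS D : measurable_fun D (fun s => (h s)%:E).
  by apply/measurable_EFinP; exact: measurable_funTS.
rewrite ge0_integral_setU//; last 3 first.
- exact: measurableU.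
- exact: mhS.
- apply/disj_setPS => s [/=]; rewrite !in_itv/= andbT => s0 [/andP[s1 _]|Ls].
    by rewrite leNgt s0 in s1.
  by have := lt_trans (le_lt_trans L0 Ls) s0; rewrite ltxx.
rewrite integral0_eq ?add0e; last first.
  by move=> s /=; rewrite in_itv/= => s0; rewrite /h lt0_exponential_pdf// mulr0.
rewrite ge0_integral_setU//; last 2 first.
- exact: mhS.
- apply/disj_setPS => s [/=]; rewrite !in_itv/= andbT => /andP[_ sL] Ls.
  by rewrite leNgt Ls in sL.
have -> : (\int[mu]_(s in `]L, +oo[) (h s)%:E = (p e * expR (- l * L))%:E)%E.
  rewrite EFinM -exponential_prob_tail// /exponential_prob -ge0_integralZl//.
  - by apply: eq_integral => s; rewrite inE/= in_itv/= andbT => Ls; rewrite /h outside.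
  - apply/measurable_EFinP; apply: measurable_funS (measurable_exponential_pdf _) => //.
  - by move=> s _; rewrite lee_fin.
  - by rewrite lee_fin pe; case: ifP.
pose F s := - (expR (- l * s) * p (y + v * s)).
have dF (s : R) : is_derive s 1 F (q (y + v * s) * (l * expR (- l * s))).
  have dpv : is_derive s 1 (p \o (fun s => y + v * s))
      (l / v * (p (y + v * s) - q (y + v * s)) * v).
    apply: is_derive1_comp; apply: is_derive_eq.
    by rewrite add0r [_%:A]mulr1 [LHS]mul1r.
  apply: (is_derive_eq (is_deriveN (is_deriveM (is_derive_expRMl (- l) s) dpv))).
  by rewrite /GRing.scale/=; field.
have cF : continuous F.
  move=> x; apply: differentiable_continuous; apply/derivable1_diffP.
  by have [] := dF x.
(* [L = 0] is the case of a particle starting at the end that it heads for. *)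
have -> : (\int[mu]_(s in `[0%R, L]) (h s)%:E = (F L)%:E - (F 0)%:E)%E.
  have [L_gt0|L_le0] := ltP 0 L; last first.
    have -> : L = 0 by apply/le_anti/andP.
    by rewrite set_itv1 integral_set1 subee.
  rewrite -(@continuous_FTC2 _ (fun s => q (y + v * s) * (l * expR (- l * s))) F)//.
  - apply: eq_integral => s; rewrite inE/= in_itv/= => sL.
    rewrite /h /W absorbed_in ?inside// exponential_pdfE//.
    by case/andP: sL.
  - apply: continuous_subspaceT => s; apply: cvgM.
      apply: (@continuous_comp _ _ _ (fun s => y + v * s) q); last exact: cq.
      by apply: cvgD; [exact: cvg_cst|apply: cvgM; [exact: cvg_cst|exact: cvg_id]].
    by apply: cvgM; [exact: cvg_cst|exact: continuous_expRMl].
  - split; first by move=> s _; have [] := dF s.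
      by apply: cvg_at_right_filter; exact: cF.
    by apply: cvg_at_left_filter; exact: cF.
  - by move=> s _; rewrite derive1E; have [_ ->] := dF s.
rewrite -EFinB -EFinD /F Lv !mulr0 expR0 addr0; congr (_%:E); ring.
Qed.

End exponential.

(** * The explicit solution of the boundary value problem *)

Section exit_formula.
Context {R : realType}.
Variables (l0 l1 c0 c1 a b : R).
Hypotheses (l0_gt0 : 0 < l0) (l1_gt0 : 0 < l1) (c0_gt0 : 0 < c0) (c1_gt0 : 0 < c1).
Hypothesis drift : l0 / c0 != l1 / c1.
Hypothesis ab : a < b.

Let k := l0 / c0 - l1 / c1.
Let den := l0 * c1 * expR (k * b) - l1 * c0 * expR (k * a).
Local Notation vel := (velocity c0 c1).
Local Notation rate := (intensity l0 l1).

Definition exit_formula (j : bool) (y : R) : R :=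
  ((if j == d0 then l0 * c1 else l1 * c0) * expR (k * y) - l1 * c0 * expR (k * a))
  / den.

Lemma intensity_gt0 j : 0 < rate j.
Proof. by rewrite /intensity; case: ifP. Qed.

Lemma velocity_neq0 j : vel j != 0.
Proof. by rewrite /velocity; case: ifP => _; rewrite ?oppr_eq0 gt_eqF. Qed.

Let A_gt0 : 0 < l0 * c1. Proof. exact: mulr_gt0. Qed.
Let B_gt0 : 0 < l1 * c0. Proof. exact: mulr_gt0. Qed.

Let gapE : l0 * c1 - l1 * c0 = c0 * c1 * k.
Proof. by rewrite /k; field; rewrite !gt_eqF. Qed.

(** The sign of [k] is that of [l0 * c1 - l1 * c0] and decides the monotonicity of
    the exponential, so that numerators and denominators change sign
    together. *)
Lemma exit_formula_sign_cases :
  [/\ 0 < den, l1 * c0 <= l0 * c1 & forall y z, y <= z -> expR (k * y) <= expR (k * z)] \/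
  [/\ den < 0, l0 * c1 <= l1 * c0 & forall y z, y <= z -> expR (k * z) <= expR (k * y)].
Proof.
have c01 : 0 < c0 * c1 by exact: mulr_gt0.
have : k != 0 by rewrite subr_eq0.
rewrite neq_lt => /orP[k_lt0|k_gt0]; [right|left].
- have mono y z : y <= z -> expR (k * z) <= expR (k * y).
    by move=> yz; rewrite ler_expR ler_nM2l.
  have BA : l0 * c1 < l1 * c0 by rewrite -subr_lt0 gapE pmulr_rlt0.
  split => //; last exact: ltW.
  rewrite subr_lt0; apply: (@lt_le_trans _ _ (l1 * c0 * expR (k * b))).
    by rewrite ltr_pM2r ?expR_gt0.
  by rewrite ler_pM2l// mono// ltW.
- have mono y z : y <= z -> expR (k * y) <= expR (k * z).
    by move=> yz; rewrite ler_expR ler_pM2l.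
  have BA : l1 * c0 < l0 * c1 by rewrite -subr_gt0 gapE pmulr_rgt0.
  split => //; last exact: ltW.
  rewrite subr_gt0; apply: (@le_lt_trans _ _ (l1 * c0 * expR (k * b))).
    by rewrite ler_pM2l// mono// ltW.
  by rewrite ltr_pM2r ?expR_gt0.
Qed.

Lemma exit_formula_den_neq0 : den != 0.
Proof. by case: exit_formula_sign_cases => -[h _ _]; rewrite neq_lt h ?orbT. Qed.

Lemma exit_formula_ge0 j y : a <= y <= b -> 0 <= exit_formula j y.
Proof.
move=> /andP[ay yb]; rewrite /exit_formula.
case: exit_formula_sign_cases => -[den_s BA /(_ _ _ ay) mono].
- apply: divr_ge0; last exact: ltW.
  rewrite subr_ge0; case: ifP => _; apply: ler_pM => //; rewrite ?expR_ge0 ?ltW//.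
- rewrite -mulrNN -invrN; apply: divr_ge0; last by rewrite oppr_ge0 ltW.
  rewrite opprB subr_ge0; case: ifP => _; apply: ler_pM => //; rewrite ?expR_ge0 ?ltW//.
Qed.

Lemma exit_formula_le1 j y : a <= y <= b -> exit_formula j y <= 1.
Proof.
move=> /andP[ay yb]; rewrite -subr_ge0 /exit_formula.
set A' := if _ then _ else _.
have -> : 1 - (A' * expR (k * y) - l1 * c0 * expR (k * a)) / den =
    (l0 * c1 * expR (k * b) - A' * expR (k * y)) / den.
  by rewrite /den; field; exact: exit_formula_den_neq0.
have A'0 : 0 <= A' by rewrite /A'; case: ifP => _; exact: ltW.
case: exit_formula_sign_cases => -[den_s BA /(_ _ _ yb) mono].
- apply: divr_ge0; last exact: ltW.
  rewrite subr_ge0; apply: ler_pM => //; rewrite ?expR_ge0//.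
  by rewrite /A'; case: ifP.
- rewrite -mulrNN -invrN; apply: divr_ge0; last by rewrite oppr_ge0 ltW.
  rewrite opprB subr_ge0; apply: ler_pM => //; rewrite ?expR_ge0 ?(ltW A_gt0)//.
  by rewrite /A'; case: ifP.
Qed.

Lemma is_derive_exit_formula j (y : R) : is_derive y 1 (exit_formula j)
  (rate j / vel j * (exit_formula j y - exit_formula (~~ j) y)).
Proof.
have -> : exit_formula j = fun y => (den^-1 * (if j == d0 then l0 * c1 else l1 * c0))
    * expR (k * y) + (- (l1 * c0 * expR (k * a)) / den).
  by apply/funext => z; rewrite /exit_formula; field; exact: exit_formula_den_neq0.
have h := is_deriveD
  (is_deriveZ (den^-1 * (if j == d0 then l0 * c1 else l1 * c0))
    (is_derive_expRMl k y))
  (is_derive_cst (- (l1 * c0 * expR (k * a)) / den) y 1).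
apply: (is_derive_eq h).
rewrite /GRing.scale/= addr0 /exit_formula /rate /vel /d0.
have := exit_formula_den_neq0; move: den (expR (k * y)) (expR (k * a)) => D E G D0.
by rewrite /k; case: j {h} => /=; field; rewrite D0 (gt_eqF c0_gt0) (gt_eqF c1_gt0).
Qed.

Lemma continuous_exit_formula j : continuous (exit_formula j).
Proof.
move=> y; apply: differentiable_continuous; apply/derivable1_diffP.
by have [] := is_derive_exit_formula j y.
Qed.

Lemma exit_formula_boundary j :
  exit_formula j (if 0 < vel j then b else a) = if 0 < vel j then 1 else 0.
Proof.
rewrite /velocity /exit_formula; case: ifP => _.
  by rewrite c0_gt0 -/den divff// exit_formula_den_neq0.
by rewrite oppr_gt0 ltNge ltW//= subrr mul0r.
Qed.

End exit_formula.

(** * The walk of the turning points, frozen outside the interval *)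

Section frozen_walk.
Context d (Omega : measurableType d) (R : realType).
Variables (l0 l1 c0 c1 a b x : R).
Hypotheses (l0_gt0 : 0 < l0) (l1_gt0 : 0 < l1) (c0_gt0 : 0 < c0) (c1_gt0 : 0 < c1).
Hypothesis drift : l0 / c0 != l1 / c1.
Hypothesis ab : a < b.
Variable j : bool.
Variables (mu : {finite_measure set Omega -> \bar R}) (S : nat -> Omega -> R).
Hypothesis mS : forall n, measurable_fun setT (S n).

Let v n : R := velocity c0 c1 (j (+) odd n).
Let l n : R := intensity l0 l1 (j (+) odd n).
Let l_gt0 n : 0 < l n. Proof. exact: intensity_gt0. Qed.
Let nu n := exponentialP (l_gt0 n).

Hypothesis S_law : forall n (B : nat -> set R), (forall i, measurable (B i)) ->
  mu [set w | forall i, (i < n)%N -> B i (S i w)] =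
  (mu setT * (\prod_(i < n) fine (exponential_prob (l i) (B i)))%:E)%E.

Definition frozen_step (u : R) (z : R * R) : R :=
  if a <= z.1 <= b then z.1 + u * z.2 else z.1.

Lemma measurable_frozen_step u : measurable_fun setT (frozen_step u).
Proof.
apply: measurable_fun_ifT.
- by apply: measurable_and; apply: measurable_fun_ler.
- by apply: measurable_funD => //; exact: measurable_funM.
- exact: measurable_fst.
Qed.

Definition frozen_walk (n : nat) (w : Omega) : R :=
  chain S (fun n => frozen_step (v n)) x n w.

Lemma measurable_frozen_walk n : measurable_fun setT (frozen_walk n).
Proof. by apply: measurable_chain => // m; exact: measurable_frozen_step. Qed.

Let F i := exit_formula l0 l1 c0 c1 a b (j (+) odd i).

(** The direction alternates, so after step [n] the function [F n] has become
    [F n.+1]; outside [a, b] neither the walk nor its value changes. *)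
Lemma frozen_walk_invariant n :
  (\int[mu]_w (absorbed a b (F n) (frozen_walk n w))%:E =
   (absorbed a b (F 0) x)%:E * mu setT)%E.
Proof.
have cF i : continuous (F i) by exact: continuous_exit_formula.
have F0 i y : a <= y <= b -> 0 <= F i y by exact: exit_formula_ge0.
apply: (@integral_chain_invariant _ _ _ _ _ _ _ mu nu S (fun n => frozen_step (v n)) x
  mS _ S_law (fun i y => (absorbed a b (F i) y)%:E)) => [i|i|i y|i y].
- exact: measurable_frozen_step.
- apply/measurable_EFinP; apply: measurable_absorbed.
  by apply: continuous_measurable_fun; exact: cF.
- rewrite lee_fin /absorbed; case: ltP => // ay; case: ltP => // yb.
  by rewrite F0// ay.
rewrite /frozen_step/=; have [yab|yab] := boolP (a <= y <= b); last first.
  rewrite -[LHS]/(\int[nu i]_s (cst (absorbed a b (F i.+1) y)%:E s))%E.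
  rewrite integral_cst// [X in (_ * X)%E](probability_setT (nu i)) mule1; congr (_%:E).
  rewrite /absorbed; case: ltP => // ay; case: ltP => // yb.
  by rewrite ay yb in yab.
have -> : absorbed a b (F i) y = F i y by exact: absorbed_in.
apply: (@integral_exponential_renewal _ (l i) (v i) a b (F i) (F i.+1) y (l_gt0 i)) => //.
- exact: velocity_neq0.
- move=> z.
  have := is_derive_exit_formula l1_gt0 c0_gt0 c1_gt0 drift ab (j (+) odd i) z.
  by rewrite /F /= addbN.
- exact: exit_formula_boundary.
- by move=> z zab; exact: F0.
Qed.

(** A particle of velocity [v] that is still inside after a sojourn has moved for
    a time of at most [(b - a) / |v|]; this is the larger of the two probabilities
    of such a short sojourn. *)
Definition stay_rate : R :=
  Num.max (1 - expR (- l0 * ((b - a) / c0))) (1 - expR (- l1 * ((b - a) / c1))).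

Lemma frozen_walk_inside n :
  (mu (frozen_walk n @^-1` `[a, b]%classic) <= (stay_rate ^+ n)%:E * mu setT)%E.
Proof.
pose L n := (b - a) / `|v n|.
have L0 i : 0 <= L i by rewrite divr_ge0// subr_ge0 ltW.
apply: (@chain_stay _ _ _ _ _ _ _ mu nu S (fun n => frozen_step (v n)) x
  mS _ S_law `[a, b]%classic (fun n => ~` `]L n, +oo[%classic)) => //.
- by move=> i; exact: measurable_frozen_step.
- by move=> i; exact: measurableC.
- move=> i [y s]; rewrite /frozen_step/= !in_itv/=; case: ifPn => [yab|/negP//].
  move=> /andP[ay' yb']; split => //; case/andP: yab => ay yb.
  rewrite andbT; apply/negP; rewrite -leNgt /L ler_pdivlMr ?normr_gt0 ?velocity_neq0//.
  rewrite (le_trans (ler_norm _))// normrM normr_id -normrM.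
  by rewrite ler_norml mulrC; apply/andP; split; lra.
- move=> i; rewrite probability_setC//= /nu /= exponential_prob_tail//.
  rewrite -EFinB lee_fin le_max /L /v /l /velocity /intensity.
  by case: ifP => _; rewrite ?normrN gtr0_norm// lexx ?orbT.
Qed.

Lemma stay_rate_lt1 : `|stay_rate| < 1.
Proof.
rewrite ger0_norm; last first.
  rewrite le_max subr_ge0 -expR0 ler_expR mulNr oppr_le0.
  by rewrite !mulr_ge0 ?invr_ge0 ?subr_ge0// ltW.
by rewrite gt_max !ltrBlDr !ltrDl !expR_gt0.
Qed.

(** The mean of the value function and the mass of [E] lie between the same two
    masses, whose difference is that of the walk being still inside. *)
Lemma frozen_walk_squeeze (E : set Omega) : a <= x <= b -> measurable E ->
  (forall n, mu (frozen_walk n @^-1` `]b, +oo[%classic) <= mu E)%E ->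
  (forall n, mu E <= mu (frozen_walk n @^-1` `[a, +oo[%classic))%E ->
  mu E = ((exit_formula l0 l1 c0 c1 a b j x)%:E * mu setT)%E.
Proof.
move=> xab mE lowE upE.
have mW n A : measurable A -> measurable (frozen_walk n @^-1` A).
  by apply: measurable_preimage; exact: measurable_frozen_walk.
have fin A : measurable A -> mu A \is a fin_num by exact: fin_num_measure.
have F01 n y : 0 <= absorbed a b (F n) y /\ absorbed a b (F n) y <= 1.
  rewrite /absorbed; case: ltP => // ay; case: ltP => // yb; split.
    by apply: exit_formula_ge0; rewrite ?ay.
  by apply: exit_formula_le1; rewrite ?ay.
have mF n : measurable_fun setT (fun w => (absorbed a b (F n) (frozen_walk n w))%:E).
  apply/measurable_EFinP; apply: measurableT_comp; last exact: measurable_frozen_walk.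
  apply: measurable_absorbed; apply: continuous_measurable_fun.
  exact: continuous_exit_formula.
set f := exit_formula _ _ _ _ _ _ _ _.
have inv n : (\int[mu]_w (absorbed a b (F n) (frozen_walk n w))%:E = f%:E * mu setT)%E.
  by rewrite frozen_walk_invariant absorbed_in// /F addbF.
have low n : (mu (frozen_walk n @^-1` `]b, +oo[%classic) <= f%:E * mu setT)%E.
  rewrite -(inv n) -[X in (mu X <= _)%E]setIT -integral_indic//; last exact: mW.
  apply: ge0_le_integral => // [|w _].
    by apply/measurable_EFinP; apply: measurable_indic; exact: mW.
  rewrite lee_fin indicE; case: (boolP (w \in _)); last first.
    by have [] := F01 n (frozen_walk n w).
  rewrite inE/= in_itv/= andbT => bw.
  by rewrite /absorbed bw ltNge (ltW (lt_trans ab bw)).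
have up n : (f%:E * mu setT <= mu (frozen_walk n @^-1` `[a, +oo[%classic))%E.
  rewrite -(inv n) -[X in (_ <= mu X)%E]setIT -integral_indic//; last exact: mW.
  apply: ge0_le_integral => //.
  - by move=> w _; rewrite lee_fin; have [] := F01 n (frozen_walk n w).
  - by apply/measurable_EFinP; apply: measurable_indic; exact: mW.
  - move=> w _; rewrite lee_fin indicE; case: (boolP (w \in _)).
      by have [] := F01 n (frozen_walk n w).
    rewrite notin_setE/= in_itv/= andbT => /negP; rewrite -ltNge => aw.
    by rewrite /absorbed aw.
have gap n : (mu (frozen_walk n @^-1` `[a, +oo[%classic) <=
    mu (frozen_walk n @^-1` `]b, +oo[%classic) + (stay_rate ^+ n)%:E * mu setT)%E.
  apply: (@le_trans _ _ (mu (frozen_walk n @^-1` `]b, +oo[%classic) +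
      mu (frozen_walk n @^-1` `[a, b]%classic))%E); last first.
    by rewrite leeD2l// frozen_walk_inside.
  apply: le_trans (measureU2 _ _ _); try exact: mW.
  apply: le_measure; rewrite ?inE; [exact: mW|apply: measurableU; exact: mW|].
  move=> w /=; rewrite !in_itv/= !andbT => ->.
  by case: (leP (frozen_walk n w) b) => ?; [right|left].
have fE := fin _ mE; have fT := fin setT measurableT.
rewrite -(fineK fE) -(fineK fT) -EFinM; congr (_%:E).
set m := fine (mu E); set t := fine (mu setT).
apply/eqP; rewrite -subr_eq0 -normr_le0.
have cvg0 : (stay_rate ^+ n * t) @[n --> \oo] --> (0 : R).
  rewrite -[X in _ --> X](mul0r t); apply: cvgMl; exact: cvg_expr stay_rate_lt1.
apply: (cvgr_to_ge cvg0); apply: nearW => n.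
have h1 : (mu E <= f%:E * mu setT + (stay_rate ^+ n)%:E * mu setT)%E.
  by rewrite (le_trans (upE n))// (le_trans (gap n))// leeD2r.
have h2 : (f%:E * mu setT <= mu E + (stay_rate ^+ n)%:E * mu setT)%E.
  by rewrite (le_trans (up n))// (le_trans (gap n))// leeD2r.
move: h1 h2; rewrite -(fineK fE) -(fineK fT) -!EFinM -!EFinD !lee_fin -/m -/t.
by rewrite ler_norml; lra.
Qed.

End frozen_walk.

(** * Exit from an interval along a continuous path *)

Section exit_path.
Context {R : realType}.
Variables (a b : R) (f : R -> R).
Hypothesis ab : a < b.
Hypothesis f0 : a <= f 0 <= b.
Hypothesis cf : {within `[0, +oo[%classic, continuous f}.

(** Exit through the upper end, expressed without an infimum: the path gets above
    [b] without having been below [a].  This form is inherited by finite pieces of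
    the path and, by continuity, can be tested on rational times. *)
Definition leaves_above : Prop :=
  exists2 q, 0 < q & b < f q /\ forall r, 0 < r < q -> a <= f r.

Definition leaves_below : Prop :=
  exists2 q, 0 < q & f q < a /\ forall r, 0 < r < q -> f r <= b.

Lemma leaves_below_not_above : leaves_below -> ~ leaves_above.
Proof.
move=> [p p0 [pa pb]] [q q0 [qb qa]]; case: (ltgtP p q) => pq.
- by have := lt_le_trans pa (qa p _); rewrite p0 pq ltxx => /(_ isT).
- by have := lt_le_trans qb (pb q _); rewrite q0 pq ltxx => /(_ isT).
- by rewrite -pq in qb; have := lt_trans (lt_trans qb pa) ab; rewrite ltxx.
Qed.

Lemma path_continuity t e : 0 <= t -> 0 < e ->
  exists2 dl, 0 < dl & forall s, 0 <= s -> `|s - t| < dl -> `|f s - f t| < e.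
Proof.
move=> t0 e0; have /subspace_continuousP /(_ t) := cf.
rewrite /= in_itv/= andbT => /(_ t0) /cvgrPdist_lt /(_ e e0).
rewrite near_withinE => /nbhs_ballP [dl dl0 h]; exists dl => // s s0 st.
by rewrite distrC; apply: h; rewrite /= ?in_itv/= ?s0// /ball/= distrC.
Qed.

Lemma path_stays_below t c : 0 <= t -> f t < c ->
  exists2 dl, 0 < dl & forall s, 0 <= s -> `|s - t| < dl -> f s < c.
Proof.
move=> t0 tc; have [|dl dl0 h] := @path_continuity t (c - f t) t0.
  by rewrite subr_gt0.
by exists dl => // s s0 /(h s s0); rewrite ltr_norml; lra.
Qed.

Lemma path_stays_above t c : 0 <= t -> c < f t ->
  exists2 dl, 0 < dl & forall s, 0 <= s -> `|s - t| < dl -> c < f s.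
Proof.
move=> t0 tc; have [|dl dl0 h] := @path_continuity t (f t - c) t0.
  by rewrite subr_gt0.
by exists dl => // s s0 /(h s s0); rewrite ltr_norml; lra.
Qed.

Lemma leaves_above_rat : leaves_above <->
  exists2 q : rat, 0 < ratr q :> R &
    b < f (ratr q) /\ forall r : rat, 0 < (ratr r : R) < ratr q -> a <= f (ratr r).
Proof.
split=> [[q q0 [qb qa]]|[q q0 [qb qa]]].
- have [dl dl0 near_q] := path_stays_above (ltW q0) qb.
  have [|p] := @rat_in_itvoo R (Num.max 0 (q - dl)) q.
    by rewrite gt_max q0 ltrBlDr ltrDl.
  rewrite in_itv/= gt_max => /andP[/andP[p0 pdl] pq].
  exists p => //; split.
    by apply: near_q; [exact: ltW|rewrite ltr_norml; lra].
  by move=> r /andP[r0 rp]; apply: qa; rewrite r0 (lt_trans rp).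
- exists (ratr q) => //; split=> // t /andP[t0 tq].
  rewrite leNgt; apply/negP => fta.
  have [dl dl0 near_t] := path_stays_below (ltW t0) fta.
  have [|p] := @rat_in_itvoo R (Num.max 0 (t - dl)) t.
    by rewrite gt_max t0 ltrBlDr ltrDl.
  rewrite in_itv/= gt_max => /andP[/andP[p0 pdl] pt].
  have : f (ratr p) < a.
    by apply: near_t; [exact: ltW|rewrite ltr_norml; lra].
  by rewrite ltNge qa// p0 (lt_trans pt).
Qed.

(** At the infimum of the exit times the path takes the value [b] exactly when the
    exit times that accumulate there are above [b], continuity excluding that
    values below [a] occur nearby. *)
Lemma first_exit_at_b :
  (exists2 tau : R,
    ereal_inf [set t%:E | t in [set t : R | 0 < t /\ f t \notin `[a, b]]] = tau%:E
    & f tau = b) <-> leaves_above.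
Proof.
set E := [set t : R | 0 < t /\ f t \notin `[a, b]].
have lbE : lbound E 0 by move=> t [t0 _]; exact: ltW.
have outE t : 0 < t -> ~ E t -> a <= f t <= b.
  by move=> t0 nE; apply/negPn/negP => h; apply: nE; split=> //; rewrite in_itv.
have [fa0 fb0] := andP f0.
split=> [[tau Etau ftau]|[q q0 [qb qa]]].
- have tau0 : 0 <= tau.
    rewrite -lee_fin -Etau; apply: le_ereal_inf_tmp => _ [t Et <-].
    by rewrite lee_fin lbE.
  have tauE t : E t -> tau <= t.
    by move=> Et; rewrite -lee_fin -Etau; apply: ereal_inf_lbound; exists t.
  have [|dl dl0 near_tau] := @path_stays_above tau a tau0; first by rewrite ftau.
  have [|_ [t Et <-]] := @lb_ereal_inf_adherent R [set t%:E | t in E] dl dl0.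
    by rewrite Etau.
  rewrite Etau -EFinD lte_fin => ttau.
  have tau_le_t := tauE t Et; have [t0 ftnot] := Et.
  exists t => //; split.
    have fta : a < f t by apply: near_tau; [exact: ltW|rewrite ltr_norml; lra].
    by rewrite ltNge; apply: contra ftnot => ftb; rewrite in_itv/= ftb ltW.
  move=> r /andP[r0 rt]; have [rtau|taur] := ltP r tau.
    have /andP[//] : a <= f r <= b.
    by apply: outE => // /tauE; rewrite leNgt rtau.
  by apply/ltW/near_tau; [exact: ltW|rewrite ltr_norml; lra].
- have Eq : E q by split => //; rewrite in_itv/= [f q <= b]leNgt qb andbF.
  have infE : has_inf E by split; [exists q|exists 0].
  exists (inf E); first by apply: ereal_inf_EFin; [exists 0|exists q].
  set tau := inf E.
  have tauE t : E t -> tau <= t by move=> Et; apply: ge_inf => //; exists 0.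
  have tau0 : 0 <= tau by apply: lb_le_inf => //; exists q.
  apply/le_anti/andP; split.
    have [tau_gt0|tau_le0] := ltP 0 tau; last first.
      by have -> : tau = 0 by apply/le_anti; rewrite tau_le0 tau0.
    rewrite leNgt; apply/negP => ftb.
    have [dl dl0 near_tau] := path_stays_above tau0 ftb.
    (* A time just before [tau], taken positive so that it would be an exit. *)
    pose r := Num.max (tau / 2) (tau - dl / 2).
    have r0 : 0 < r by rewrite lt_max divr_gt0.
    have rtau : r < tau by rewrite gt_max; apply/andP; split; lra.
    have rdl : tau - dl / 2 <= r by rewrite le_max lexx orbT.
    have frb : b < f r.
      by apply: near_tau; [exact: ltW|rewrite ltr_norml; lra].
    have /andP[_] : a <= f r <= b by apply: outE => // /tauE; rewrite leNgt rtau.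
    by rewrite leNgt frb.
  rewrite leNgt; apply/negP => ftb.
  have [dl dl0 near_tau] := path_stays_below tau0 ftb.
  have tauq : tau < q.
    by rewrite lt_neqAle tauE// andbT; apply: contraTneq qb => <-; rewrite -leNgt ltW.
  have [|t Et] := @inf_adherent R E (Num.min dl (q - tau)) _ infE.
    by rewrite lt_min dl0 subr_gt0.
  rewrite -/tau => ttau; have := tauE t Et => taut.
  have [t0 ftnot] := Et.
  have tdl : t < tau + dl by rewrite (lt_le_trans ttau)// lerD2l ge_min lexx.
  have tq : t < q.
    by rewrite (lt_le_trans ttau)// -lerBrDl ge_min lexx orbT.
  have ftb' : f t < b by apply: near_tau; [exact: ltW|rewrite ltr_norml; lra].
  by move/negP: ftnot; apply; rewrite in_itv/= qa ?t0 ?tq//= ltW.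
Qed.

End exit_path.

(** * Measurability of the exit event *)

Lemma measurable_leaves_above d (Omega : measurableType d) (R : realType)
    (a b : R) (X : R -> Omega -> R) :
  (forall t, measurable_fun setT (X t)) ->
  (forall w, {within `[0, +oo[%classic, continuous (X ^~ w)}) ->
  measurable [set w | leaves_above a b (X ^~ w)].
Proof.
move=> mX cX.
pose V (q : rat) := if 0 < ratr q :> R then
  X (ratr q) @^-1` `]b, +oo[%classic `\`
    \bigcup_r (if 0 < (ratr r : R) < ratr q then X (ratr r) @^-1` `]-oo, a[%classic
               else set0)
  else set0.
have -> : [set w | leaves_above a b (X ^~ w)] = \bigcup_q V q.
  apply/seteqP; split => [w /(leaves_above_rat a b (cX w))|w].
  - move=> [q q0 [qb qa]]; exists q => //; rewrite /V q0; split.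
      by rewrite /= in_itv/= qb.
    move=> [r _]; case: ifP => // /qa; rewrite /= in_itv/= => h.
    by rewrite ltNge h.
  - move=> [q _]; rewrite /V; case: ifP => // q0 [/=]; rewrite in_itv/= andbT => qb nr.
    apply/(leaves_above_rat a b (cX w)); exists q => //; split => // r rq.
    by rewrite leNgt; apply/negP => h; apply: nr; exists r => //; rewrite rq /= in_itv.
apply: bigcupT_measurable_rat => q; rewrite /V; case: ifP => // _.
apply: measurableD; first exact: measurable_preimage.
apply: bigcupT_measurable_rat => r; case: ifP => // _.
exact: measurable_preimage.
Qed.

(** * The turning points decide the exit of a piecewise linear path *)

Section piecewise_linear_path.
Context d (Omega : measurableType d) (R : realType).
Variables (c0 c1 a b x : R) (j : bool) (S : nat -> Omega -> R) (w : Omega).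
Variable f : R -> R.
Let T n := \sum_(i < n) S i w.
Let v n : R := velocity c0 c1 (j (+) odd n).
Hypothesis S_ge0 : forall i, 0 <= S i w.
Hypothesis xab : a <= x <= b.
Hypothesis f0 : f 0 = x.
Hypothesis f_lin : forall n t, T n <= t <= T n.+1 ->
  f t - f (T n) = v n * (t - T n).

(** On each linear piece the path stays between its two end values, so that the
    turning points decide which end of the interval is crossed first. *)
Lemma frozen_walk_path n : let Y := frozen_walk c0 c1 a b x j S n w in
  [/\ a <= Y <= b -> f (T n) = Y /\ forall t, 0 <= t <= T n -> a <= f t <= b,
      b < Y -> leaves_above a b f
    & Y < a -> leaves_below a b f].
Proof.
have T0 : T 0 = 0 by rewrite /T big_ord0.
have TS n' : T n'.+1 = T n' + S n' w by rewrite /T big_ord_recr.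
have T_ge0 n' : 0 <= T n' by apply: sumr_ge0 => i _.
have [xa xb] := andP xab.
elim: n => [|n] /=.
  rewrite T0 f0; split=> [_|bx|ax].
  - by split=> // t /le_anti <-; rewrite f0.
  - by move: xb; rewrite leNgt bx.
  - by move: xa; rewrite leNgt ax.
rewrite /frozen_walk /=; set Y := chain _ _ _ _ _ => -[inY upY downY].
rewrite /frozen_step/=; have [Yab|Yab] := boolP (a <= Y <= b); last first.
  by split=> // h; move: Yab; rewrite h.
have [fY fin] := inY Yab; have [Ya Yb] := andP Yab.
have S0 := S_ge0 n.
have lin t : T n <= t <= T n.+1 -> f t = Y + v n * (t - T n).
  by move=> /f_lin; rewrite fY; lra.
have fS : f (T n.+1) = Y + v n * S n w.
  rewrite lin; first by rewrite TS [T n + _]addrC addrK.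
  by rewrite lexx andbT TS lerDl.
have between t : T n <= t <= T n.+1 ->
    (0 <= v n * (t - T n) <= v n * S n w) || (v n * S n w <= v n * (t - T n) <= 0).
  rewrite TS => /andP[t1 t2].
  have u0 : 0 <= t - T n by rewrite subr_ge0.
  have uS : t - T n <= S n w by rewrite lerBlDl.
  have [v0|v0] := leP 0 (v n).
    by rewrite mulr_ge0//= ler_wpM2l.
  by rewrite orbC mulr_le0_ge0 ?(ltW v0)//= andbT ler_wnM2l// ltW.
have cases t : 0 <= t <= T n.+1 -> t <= T n \/ T n <= t <= T n.+1.
  by move=> /andP[_ ->]; case: (leP t (T n)) => h; [left|right; rewrite ltW].
have pos : f (T n.+1) != x -> 0 < T n.+1.
  by move=> h; rewrite lt_neqAle T_ge0 andbT; apply: contraNneq h => <-; rewrite f0.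
rewrite -fS; split=> [fab|bf|fa].
- split=> // t tT; case: (cases t tT) => [tn|tn].
    by apply: fin; rewrite tn andbT; case/andP: tT.
  move: (between t tn) fab; rewrite (lin t tn) fS.
  by case/orP=> /andP[? ?] /andP[? ?]; apply/andP; split; lra.
- exists (T n.+1); first by apply: pos; rewrite gt_eqF// (le_lt_trans xb).
  split=> // t /andP[t0 tT]; have tT' : 0 <= t <= T n.+1 by rewrite !ltW.
  case: (cases t tT') => [tn|tn].
    by have /andP[] // : a <= f t <= b by apply: fin; rewrite tn ltW.
  by move: (between t tn) bf; rewrite (lin t tn) fS; case/orP=> /andP[? ?] ?; lra.
- exists (T n.+1); first by apply: pos; rewrite lt_eqF// (lt_le_trans fa).
  split=> // t /andP[t0 tT]; have tT' : 0 <= t <= T n.+1 by rewrite !ltW.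
  case: (cases t tT') => [tn|tn].
    by have /andP[] // : a <= f t <= b by apply: fin; rewrite tn ltW.
  by move: (between t tn) fa; rewrite (lin t tn) fS; case/orP=> /andP[? ?] ?; lra.
Qed.

End piecewise_linear_path.

Lemma le_measure_ae d (T : measurableType d) (R : realType)
    (mu : {measure set T -> \bar R}) (A B : set T) :
  measurable A -> measurable B -> {ae mu, forall w, A w -> B w} ->
  (mu A <= mu B)%E.
Proof.
move=> mA mB [N [mN N0 AB]].
apply: (@le_trans _ _ (mu (B `|` N))).
  apply: le_measure; rewrite ?inE//; first exact: measurableU.
  move=> w Aw; have [Bw|nBw] := pselect (B w); [by left|right].
  by apply: AB => /(_ Aw).
by apply: le_trans (measureU2 _ mB mN) _; rewrite [X in (_ + X)%E]N0 adde0.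
Qed.

(** * Exit probabilities of the telegraph process *)

Section telegraph_exit.
Context d (Omega : measurableType d) (R : realType) (P : probability Omega R).
Variables (l0 l1 c0 c1 a b x : R).
Hypotheses (l0_gt0 : 0 < l0) (l1_gt0 : 0 < l1) (c0_gt0 : 0 < c0) (c1_gt0 : 0 < c1).
Hypothesis drift : l0 / c0 != l1 / c1.
Hypothesis ab : a < b.
Hypothesis xab : a <= x <= b.
Variables (D : R -> {RV P >-> bool}) (X : R -> {RV P >-> R}).
Hypothesis telegraph : telegraph_process l0 l1 c0 c1 x D X.

Let Dj (j : bool) := [set w | D 0 w = j].

Lemma measurable_initial_direction j : measurable (Dj j).
Proof. exact: (measurable_preimage (A := [set j])). Qed.

Lemma initial_direction_law j : P (Dj j) = (2^-1)%:E.
Proof. by case: telegraph => _ _ ->. Qed.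

Lemma exits_at_bE : exits_at b a b X = [set w | leaves_above a b (X ^~ w)].
Proof.
case: telegraph => X0 cX _ _ _; apply/seteqP; split => w /=.
  by move/first_exit_at_b; apply=> //; rewrite X0.
by move/first_exit_at_b; apply=> //; rewrite X0.
Qed.

Lemma measurable_exits_at_b : measurable (exits_at b a b X).
Proof.
rewrite exits_at_bE; apply: measurable_leaves_above => //.
by case: telegraph.
Qed.

Section sojourns.
Variables (j : bool) (S : nat -> {RV P >-> R}).
Hypothesis S_law : sojourn_law l0 l1 (D 0) S.

Lemma joint_sojourn_law n (B : nat -> set R) : (forall i, measurable (B i)) ->
  P ([set w | forall i, (i < n)%N -> B i (S i w)] `&` Dj j) =
  ((2^-1)%:E * (\prod_(i < n)
     fine (exponential_prob (intensity l0 l1 (j (+) odd i)) (B i)))%:E)%E.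
Proof.
move=> mB; rewrite -S_law//; set A := [set w | _].
have mA : measurable (A `&` Dj j).
  apply: measurableI; last exact: measurable_initial_direction.
  have -> : A = \bigcap_(i in `I_n) (S i @^-1` B i).
    by apply/seteqP; split => w Aw i ik; exact: Aw.
  by apply: bigcap_measurableType => // i _; exact: measurable_preimage.
rewrite /cond_prob -/(Dj j) initial_direction_law/= -EFinM mulrC.
by rewrite divfK ?invr_eq0 ?pnatr_eq0// fineK// fin_num_measure.
Qed.

(** The exponential law has no mass on the negative half-line. *)
Lemma sojourns_ge0 : {ae P, forall w, D 0 w = j -> forall i, 0 <= S i w}.
Proof.
have negl i : P.-negligible ([set w | S i w < 0] `&` Dj j).
  (* Constrain the [i]-th sojourn only. *)
  pose B k := if k == i then `]-oo, (0 : R)[%classic else setT.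
  have mB k : measurable (B k) by rewrite /B; case: ifP.
  exists ([set w | forall k, (k < i.+1)%N -> B k (S k w)] `&` Dj j); split.
  - apply: measurableI; last exact: measurable_initial_direction.
    rewrite (_ : [set w | _] = \bigcap_(k in `I_i.+1) (S k @^-1` B k)); last first.
      by apply/seteqP; split => w Aw k ik; exact: Aw.
    by apply: bigcap_measurableType => // k _; exact: measurable_preimage.
  - rewrite joint_sojourn_law// (bigD1 ord_max)//= {1}/B eqxx.
    rewrite /exponential_prob integral0_eq ?mul0r ?mule0//.
    by move=> t /=; rewrite in_itv/= => t0; rewrite lt0_exponential_pdf.
  - move=> w [/= Sw Dw]; split => // k _; rewrite /B; case: eqP => // ->.
    by rewrite /= in_itv.
have := negligible_bigcup negl; apply: negligibleS => w /= nh.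
apply: contrapT => h; apply: nh => Dw i; rewrite leNgt; apply/negP => Si.
by apply: h; exists i.
Qed.

End sojourns.

(** [frozen_walk_squeeze] under the measure [Q], which is [P] restricted to the
    initial direction [j]; the two bounds that it asks for hold almost surely,
    path by path. *)
Lemma exit_probability j :
  P (exits_at b a b X `&` Dj j) = ((exit_formula l0 l1 c0 c1 a b j x) / 2)%:E.
Proof.
case: telegraph => X0 cX _ [S [S_law D_S]] X_lin.
pose Q : {finite_measure set Omega -> \bar R} := mrestr P (measurable_initial_direction j).
have mE := measurable_exits_at_b.
have mS n : measurable_fun setT (S n : Omega -> R) by [].
have QT : Q setT = (2^-1)%:E by rewrite /Q /= /mrestr setTI initial_direction_law.
have Q_law n (B : nat -> set R) : (forall i, measurable (B i)) ->
    Q [set w | forall i, (i < n)%N -> B i (S i w)] =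
    (Q setT * (\prod_(i < n)
       fine (exponential_prob (intensity l0 l1 (j (+) odd i)) (B i)))%:E)%E.
  by move=> mB; rewrite QT; exact: joint_sojourn_law.
pose Y n := frozen_walk c0 c1 a b x j (fun i => S i : Omega -> R) n.
have mY n A : measurable A -> measurable (Y n @^-1` A).
  by apply: measurable_preimage; exact: measurable_frozen_walk.
have mDj A : measurable A -> measurable (A `&` Dj j).
  by move=> mA; apply: measurableI => //; exact: measurable_initial_direction.
have coupling : {ae P, forall w, D 0 w = j -> forall n,
    (b < Y n w -> exits_at b a b X w) /\ (Y n w < a -> ~ exits_at b a b X w)}.
  have SP := sojourns_ge0 j S_law.
  apply: filterS3 SP D_S X_lin => w S0 DS Xlin Dw n; rewrite exits_at_bE /=.
  have T_ge0 m : 0 <= reversal_time S m w by apply: sumr_ge0 => i _; exact: S0.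
  have lin m t : \sum_(i < m) S i w <= t <= \sum_(i < m.+1) S i w ->
      X t w - X (\sum_(i < m) S i w) w =
      velocity c0 c1 (j (+) odd m) * (t - \sum_(i < m) S i w).
    move=> /andP[t1 t2]; apply: Xlin; first by rewrite t1 andbT; exact: T_ge0.
    move=> r /andP[r1 r2]; rewrite -Dw; apply: DS.
    by rewrite r1 /= (lt_le_trans r2).
  have [_ up down] := @frozen_walk_path _ Omega R c0 c1 a b x j
    (fun i => S i : Omega -> R) w (X ^~ w) (S0 Dw) xab (X0 w) lin n.
  by split => [/up//|/down]; exact: leaves_below_not_above.
have := @frozen_walk_squeeze _ Omega R l0 l1 c0 c1 a b x
  l0_gt0 l1_gt0 c0_gt0 c1_gt0 drift ab j Q (fun i => S i : Omega -> R)
  mS Q_law _ xab mE.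
rewrite QT -EFinM; apply => n.
- apply: (@le_measure_ae _ _ _ P (Y n @^-1` `]b, +oo[%classic `&` Dj j)
    (exits_at b a b X `&` Dj j)); [by apply/mDj/mY|exact: mDj|].
  apply: filterS coupling => w /[swap] -[/= bY Dw] /(_ Dw n)[+ _].
  by move: bY; rewrite in_itv/= andbT => bY /(_ bY).
- apply: (@le_measure_ae _ _ _ P (exits_at b a b X `&` Dj j)
    (Y n @^-1` `[a, +oo[%classic `&` Dj j)); [exact: mDj|by apply/mDj/mY|].
  apply: filterS coupling => w /[swap] -[/= Ew Dw] /(_ Dw n)[_ nE].
  by split => //=; rewrite in_itv/= andbT leNgt; apply/negP => /nE.
Qed.

Lemma cond_exit_probability j :
  cond_prob P (exits_at b a b X) [set w | X 0 w = x /\ D 0 w = j] =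
  exit_formula l0 l1 c0 c1 a b j x.
Proof.
case: telegraph => X0 _ _ _ _.
have -> : [set w | X 0 w = x /\ D 0 w = j] = Dj j.
  by apply/seteqP; split => w // [].
rewrite /cond_prob exit_probability initial_direction_law/=.
by rewrite mulfK// invr_eq0 pnatr_eq0.
Qed.

Lemma total_exit_probability :
  cond_prob P (exits_at b a b X) [set w | X 0 w = x] =
  (exit_formula l0 l1 c0 c1 a b d0 x + exit_formula l0 l1 c0 c1 a b d1 x) / 2.
Proof.
case: telegraph => X0 _ _ _ _.
have -> : [set w | X 0 w = x] = setT by apply/seteqP; split => // w _; exact: X0.
rewrite /cond_prob probability_setT/= divr1 setIT.
have -> : exits_at b a b X =
    (exits_at b a b X `&` Dj d0) `|` (exits_at b a b X `&` Dj d1).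
  rewrite -setIUr (_ : _ `|` _ = setT) ?setIT//.
  apply/seteqP; split => // w _; rewrite /Dj /d0 /d1/=.
  by case: (D 0 w); [right|left].
rewrite measureU; last 3 first.
- by apply: measurableI; [exact: measurable_exits_at_b|exact: measurable_initial_direction].
- by apply: measurableI; [exact: measurable_exits_at_b|exact: measurable_initial_direction].
- by apply/seteqP; split => // w [[_ D0] [_]]; rewrite /Dj/= D0.
rewrite [X in fine (X + _)%E]exit_probability [X in fine (_ + X)%E]exit_probability.
by rewrite /= -mulrDl.
Qed.

End telegraph_exit.

Unset Implicit Arguments.


Theorem theorem3 (R : realType) (d : measure_display) (Omega : measurableType d)
  (P : probability Omega R) (l0 l1 c0 c1 a b x : R)
  (hl0 : 0 < l0) (hl1 : 0 < l1) (hc0 : 0 < c0) (hc1 : 0 < c1)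
  (hdrift : l0 / c0 != l1 / c1)
  (hab : a < b) (hx : x \in `[a, b])
  (D : R -> {RV P >-> bool}) (X : R -> {RV P >-> R})
  (hX : telegraph_process l0 l1 c0 c1 x D X) :
  let k := l0 / c0 - l1 / c1 in
  let u_ (j : bool) :=
    cond_prob P (exits_at b a b X) [set w | X 0 w = x /\ D 0 w = j] in
  let u := cond_prob P (exits_at b a b X) [set w | X 0 w = x] in
  [/\ u_ d0 = (l0 * c1 * expR (k * x) - l1 * c0 * expR (k * a))
              / (l0 * c1 * expR (k * b) - l1 * c0 * expR (k * a)),
      u_ d1 = (l1 * c0 * expR (k * x) - l1 * c0 * expR (k * a))
              / (l0 * c1 * expR (k * b) - l1 * c0 * expR (k * a)),
      u = (u_ d0 + u_ d1) / 2
    & u = 2^-1 * (((l1 * c0 + l0 * c1) * expR (k * x)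
                   - 2 * l1 * c0 * expR (k * a))
                  / (l0 * c1 * expR (k * b) - l1 * c0 * expR (k * a)))].
Proof.
have xab : a <= x <= b by rewrite in_itv/= in hx.
have cond_exit := cond_exit_probability hl0 hl1 hc0 hc1 hdrift hab xab hX.
have total_exit := total_exit_probability hl0 hl1 hc0 hc1 hdrift hab xab hX.
move=> k u_ u; rewrite /u /u_ !cond_exit total_exit.
by split=> //; rewrite /exit_formula /= -/k; ring.
Qed.
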